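(* Let $d$ be a natural number and $\alpha, \varepsilon$ positive real numbers satisfying $\alpha^{d(d-2)} \le \varepsilon < 1$. Let $G$ be a graph on $(1+\varepsilon)\alpha^{-d} n$ vertices of density at least $\alpha$. Then $G$ is universal for the family of bipartite graphs $H$ on $n$ vertices which have a vertex partition $W_1 \cup W_2$ into two independent sets such that every vertex in $W_1$ has at most $d$ neighbors in $W_2$, and such that $\frac{|W_2|^d}{|W_2|(|W_2|-1) \cdots (|W_2|-d+1)} \le 1 + \varepsilon$.
   Context: The density of a graph is the fraction of pairs of distinct vertices that form an edge. A graph $G$ is universal for a family $\mathcal{F}$ of graphs if it contains every $F\in\mathcal{F}$ as a (not necessarily induced) subgraph. *)

(* Defs.v *)
From HB Require Import structures.
From mathcomp Require Import all_boot all_order all_algebra.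
From mathcomp Require Import reals.

Set Implicit Arguments.
Unset Strict Implicit.
Unset Printing Implicit Defensive.

Import Order.TTheory GRing.Theory Num.Theory.
Local Open Scope ring_scope.

Record sgraph := SGraph {
  vertex :> finType;
  adj : rel vertex;
  adj_sym : symmetric adj;
  adj_irrefl : irreflexive adj }.

Definition edges (G : sgraph) : {set {set G}} :=
  [set e : {set G} | [exists x, exists y, adj x y && (e == [set x; y])]].

Definition density (R : realType) (G : sgraph) : R :=
  #|edges G|%:R / 'C(#|G|, 2)%:R.

Definition contains (G F : sgraph) : Prop :=
  exists f : F -> G, injective f /\ forall x y, adj x y -> adj (f x) (f y).

Definition universal (G : sgraph) (FF : sgraph -> Prop) : Prop :=
  forall F, FF F -> contains G F.

Definition independent (G : sgraph) (A : {set G}) : Prop :=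
  {in A &, forall x y, ~~ adj x y}.

(* The bound d <= #|W2| says that the denominator of the quotient is nonzero;
   it has to be explicit because x / 0 = 0 here. *)
Definition bipartite_family (R : realType) (d n : nat) (eps : R)
    (H : sgraph) : Prop :=
  #|H| = n /\
  exists W1 W2 : {set H},
    [/\ W1 :|: W2 = [set: H] /\ [disjoint W1 & W2],
        independent W1 /\ independent W2,
        forall w, w \in W1 -> (#|[set u in W2 | adj w u]| <= d)%N,
        (d <= #|W2|)%N &
        #|W2|%:R ^+ d / (#|W2| ^_ d)%:R <= 1 + eps].

(* Main.v *)
Require Import Defs.
From HB Require Import structures.
From mathcomp Require Import all_boot all_order all_algebra all_fingroup.
From mathcomp Require Import primitive_action alt ring lra zify.
From mathcomp Require Import reals.

Set Implicit Arguments.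
Unset Strict Implicit.
Unset Printing Implicit Defensive.

Import Order.TTheory GRing.Theory Num.Theory.
Local Open Scope ring_scope.

(** Put m = |W2|, r = |W1|, N = |G| and nu = N / n = (1 + eps) / alpha^d.  The
hypotheses force d >= 3.  Split V(G) at random into P and Q with |P| just above
m nu, so that |Q| > (r - 1) nu, keeping bipartite density at least alpha.  For a
random pair T in Q, let A be its common neighbourhood in P.  By convexity
E |A|^d >= (alpha^2 |P|)^d, and the pairs with |A| < m contribute at most m^d,
which is negligible because alpha^(d(d-2)) <= eps; on the other hand, the sum of
|N(S)|^(-2) over d-tuples S of A is on average at most |P|^d / |Q|^2, since S is
in A with probability (|N(S)| / |Q|)^2.  Hence some A with |A| >= m is such that
a random injection of W2 into A gives (r - 1)^2 sum_w |N(S_w)|^(-2) < r, where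
S_w is the image of a d-tuple containing the neighbours of w in W1.  Then every
nonempty U in W1 contains some w with |N(S_w)| >= |U|, and W1 is embedded in Q
greedily. *)

(** * Averaging over injections between finite sets *)

Lemma perm_map_uniq (T : finType) (d : nat) (t u : d.-tuple T) :
  uniq t -> uniq u -> exists s : {perm T}, u = map_tuple s t.
Proof.
move=> Ut Uu.
have le_d : (d <= #|T|)%N by rewrite -(card_uniq_tuple Ut) max_card.
have tr := ntransitive_weak le_d (Sym_trans T).
have inT (v : d.-tuple T) : uniq v -> v \in dtuple_on d [set: T].
  by move=> Uv; rewrite inE Uv; apply/subsetP=> x; rewrite inE.
have [s _ us] := atransP2 tr (inT _ Ut) (inT _ Uu).
by exists s; rewrite us; apply: val_inj.
Qed.

Lemma exists_injection (W T : finType) :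
  (#|W| <= #|T|)%N -> exists f : W -> T, injective f.
Proof.
move=> le_WT; exists (fun w => enum_val (widen_ord le_WT (enum_rank w))).
by move=> x y /enum_val_inj /(congr1 val) /= /val_inj /enum_rank_inj.
Qed.

Section Averaging.
Variable R : realFieldType.

(* The sum over permutations does not depend on [t], by transitivity of the
   symmetric group on uniq tuples; average it over all [t]. *)
Lemma sum_perm_uniq_tuple (T : finType) (d : nat) (g : d.-tuple T -> R)
    (t : d.-tuple T) :
  uniq t ->
  (\sum_(s : {perm T}) g (map_tuple s t)) * (#|T| ^_ d)%:R =
  #|{perm T}|%:R * \sum_(u : d.-tuple T | uniq u) g u.
Proof.
move=> Ut; pose F (u : d.-tuple T) := \sum_(s : {perm T}) g (map_tuple s u).
have F_const (u : d.-tuple T) : uniq u -> F u = F t.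
  move=> /(perm_map_uniq Ut)[s ->]; rewrite /F.
  rewrite [RHS](reindex_inj (mulgI s)) /=; apply: eq_bigr => p _; congr g.
  by apply: val_inj; rewrite /= -map_comp; apply: eq_map => x /=; rewrite permM.
transitivity (\sum_(u : d.-tuple T | uniq u) F u).
  rewrite mulr_natr -(card_uniq_tuples d T) -sumr_const.
  have allT (u : d.-tuple T) : all T u by apply/allP.
  by apply: eq_big => u; rewrite inE allT // => /F_const.
rewrite exchange_big /= -sum1_card natr_sum mulr_suml; apply: eq_bigr => s _.
rewrite mul1r; have s_inj : injective (map_tuple (n:=d) s).
  by move=> u v /(congr1 val) /= /(inj_map perm_inj) /val_inj.
rewrite [RHS](reindex_inj s_inj); apply: eq_bigl => u.
by rewrite map_inj_uniq //; apply: perm_inj.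
Qed.

(** Average over the maps [p \o f0], with [f0] a fixed injection and [p] a permutation: each [s i]
    becomes a uniform uniq tuple, so the mean of the left side is the right side, and some [p] does
    not exceed it. *)
Lemma exists_injection_le_average (T W I : finType) (d : nat)
    (s : I -> d.-tuple W) (g : d.-tuple T -> R) :
  (#|W| <= #|T|)%N -> (forall i, uniq (s i)) ->
  exists2 f : W -> T, injective f &
    (\sum_i g (map_tuple f (s i))) * (#|T| ^_ d)%:R <=
    #|I|%:R * \sum_(u : d.-tuple T | uniq u) g u.
Proof.
move=> le_WT Us.
have [f0 f0_inj] := exists_injection le_WT.
pose f (p : {perm T}) w := p (f0 w).
have f_inj p : injective (f p) by move=> x y /perm_inj /f0_inj.
pose L p := (\sum_i g (map_tuple (f p) (s i))) * (#|T| ^_ d)%:R.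
pose B := #|I|%:R * \sum_(u : d.-tuple T | uniq u) g u.
have [p le_p|no_p] := pickP (fun p => L p <= B); first by exists (f p).
have : \sum_p L p = #|{perm T}|%:R * B.
  rewrite /L -mulr_suml exchange_big /= mulr_suml /B mulrCA.
  rewrite -[#|I|]sum1_card natr_sum mulr_suml; apply: eq_bigr => i _.
  rewrite mul1r -(@sum_perm_uniq_tuple _ _ _ (map_tuple f0 (s i))); last first.
    by rewrite map_inj_uniq.
  congr (_ * _); apply: eq_bigr => p _; congr g; apply: val_inj => /=.
  by rewrite -map_comp.
rewrite -sum1_card natr_sum mulr_suml => /eqP; rewrite eq_sym lt_eqF //.
apply: ltr_sum; first by apply/hasP; exists 1%g => //; rewrite mem_index_enum.
by move=> p _; rewrite mul1r ltNge no_p.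
Qed.

(** Average in the subtype of [A]; since [g] is nonnegative, the tuples of the subtype contribute at
    most the sum over tuples lying in [A]. *)
Lemma exists_injection_into_le_average (T W I : finType) (A : {set T})
    (d : nat) (s : I -> d.-tuple W) (g : d.-tuple T -> R) :
  (forall t, 0 <= g t) -> (#|W| <= #|A|)%N -> (forall i, uniq (s i)) ->
  exists f : W -> T, [/\ injective f, forall w, f w \in A &
    (\sum_i g (map_tuple f (s i))) * (#|A| ^_ d)%:R <=
    #|I|%:R * \sum_(u : d.-tuple T | uniq u && all (mem A) u) g u].
Proof.
move=> g_ge0 le_WA Us.
pose TA : finType := {x : T | x \in A}; have cardTA : #|TA| = #|A| by rewrite card_sig.
have le_WTA : (#|W| <= #|TA|)%N by rewrite cardTA.
pose v (t : d.-tuple TA) : d.-tuple T := map_tuple val t.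
have v_inj : injective v.
  by move=> t u /(congr1 val) /= /(inj_map val_inj) /val_inj.
have [f f_inj] := @exists_injection_le_average _ _ _ _ s (g \o v) le_WTA Us.
rewrite cardTA => le_f; exists (val \o f); split=> [||].
- by move=> x y /val_inj /f_inj.
- by move=> w; apply: valP (f w).
apply: le_trans (le_trans le_f _).
  rewrite le_eqVlt; apply/orP; left; apply/eqP; congr (_ * _).
  apply: eq_bigr => i _; congr g; apply: val_inj => /=.
  by rewrite -map_comp.
apply: ler_wpM2l => //.
have -> : \sum_(u : d.-tuple TA | uniq u) (g \o v) u =
    \sum_(u in v @: [set u : d.-tuple TA | uniq u]) g u.
  rewrite big_imset /=; last by move=> ? ? _ _ /v_inj.
  by apply: eq_bigl => u; rewrite inE.
rewrite big_mkcond [X in _ <= X]big_mkcond; apply: ler_sum => u _ /=.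
case: imsetP => [[t]|_]; last by case: ifP.
rewrite inE => Ut ->; rewrite /= map_inj_uniq ?Ut; last exact: val_inj.
by have -> : all (mem A) (map val t) by apply/allP=> _ /mapP[y _ ->]; apply: valP y.
Qed.

End Averaging.

(** * Distinct representatives by greedy choice *)

Lemma greedy_transversal (I Q : finType) (N : I -> {set Q}) :
  (forall U : {set I}, U != set0 -> exists2 i, i \in U & (#|U| <= #|N i|)%N) ->
  exists2 g : I -> Q, injective g & forall i, g i \in N i.
Proof.
(* If [I] is empty, [Q] may be empty too, so a default point [q0] exists only in the other case. *)
move=> hallN; have [i0 _|I0] := pickP I; last first.
  have noI (i : I) : False by have := I0 i.
  by exists (fun i => False_rect Q (noI i)) => i; case: (noI i).
have [q0 _] : exists q, q \in N i0.
  have [|i /set1P -> ] := hallN [set i0]; first by rewrite -card_gt0 cards1.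
  by rewrite cards1 => /card_gt0P.
have partial k (U : {set I}) : #|U| = k ->
    exists2 g : I -> Q, {in U &, injective g} & {in U, forall i, g i \in N i}.
  elim: k U => [|k IHk] U cardU.
    by exists (fun=> q0) => i; rewrite (cards0_eq cardU) inE.
  have U_n0 : U != set0 by rewrite -card_gt0 cardU.
  (* [i] is placed last: the other [k] elements of [U] occupy at most [k] points, and [N i] has at
     least [k + 1]. *)
  have [i iU leN] := hallN U U_n0.
  have cardUi : #|U :\ i| = k.
    by apply: succn_inj; rewrite -cardU (cardsD1 i U) iU.
  have [g g_inj gN] := IHk _ cardUi.
  have /subsetPn[q qN qg] : ~~ (N i \subset g @: (U :\ i)).
    apply: contraTN leN => /subset_leq_card leN; rewrite -ltnNge cardU ltnS.
    by rewrite (leq_trans leN) // (leq_trans (leq_imset_card _ _)) ?cardUi.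
  have gq j : j \in U -> j != i -> (g j == q) = false.
    move=> jU ji; apply: contraNF qg => /eqP <-.
    by apply: imset_f; rewrite !inE ji.
  exists (fun j => if j == i then q else g j) => [j k' jU kU|j jU].
    case: (eqVneq j i) => [->|ji]; case: (eqVneq k' i) => [->|ki] //.
    - by move/eqP; rewrite eq_sym gq.
    - by move/eqP; rewrite gq.
    by apply: g_inj; rewrite !inE ?ji ?ki.
  by case: eqVneq => [->|ji] //; apply: gN; rewrite !inE ji.
have [g g_inj gN] := partial _ setT erefl.
by exists g => [i j|i]; [apply: g_inj | apply: gN]; rewrite inE.
Qed.

(** * Dependent random choice in a bipartite graph *)

Section Bipartite.
Variable R : realFieldType.

(** Convexity, by induction: [x] times the bound for one exponent exceeds the next bound by a
    nonnegative multiple of [(x - c) ^+ 2]. *)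
Lemma tangent_exprS_le (c x : R) (d : nat) : 0 <= c -> 0 <= x ->
  c ^+ d.+1 + d.+1%:R * c ^+ d * (x - c) <= x ^+ d.+1.
Proof.
move=> c_ge0 x_ge0; elim: d => [|d IHd]; first by rewrite !expr1 expr0; lra.
rewrite [x ^+ _]exprS; apply: le_trans (ler_wpM2l x_ge0 IHd).
rewrite -subr_ge0.
have -> : x * (c ^+ d.+1 + d.+1%:R * c ^+ d * (x - c)) -
    (c ^+ d.+2 + d.+2%:R * c ^+ d.+1 * (x - c)) =
    d.+1%:R * c ^+ d * (x - c) ^+ 2.
  by rewrite -[d.+2%:R]natr1 !exprS; ring.
by rewrite mulr_ge0 ?sqr_ge0 // mulr_ge0 ?exprn_ge0.
Qed.

(** Jensen's inequality: sum the tangents at [c]; their linear parts add up to a nonnegative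
    amount. *)
Lemma power_mean_le (I : finType) (x : I -> R) (c : R) (d : nat) :
  0 <= c -> (forall i, 0 <= x i) -> #|I|%:R * c <= \sum_i x i ->
  #|I|%:R * c ^+ d <= \sum_i x i ^+ d.
Proof.
move=> c_ge0 x_ge0 le_cx; case: d => [|d].
  by under eq_bigr do rewrite expr0; rewrite expr0 mulr1 sumr_const.
apply: le_trans (ler_sum _ (fun i _ => tangent_exprS_le d c_ge0 (x_ge0 i))).
rewrite big_split /= -mulr_sumr sumrB !sumr_const -[c ^+ _ *+ _]mulr_natl lerDl.
by rewrite mulr_ge0 ?subr_ge0 // ?mulr_ge0 ?exprn_ge0 // -mulr_natl.
Qed.

Variables (P Q : finType) (e : P -> Q -> bool).

Definition common_left (T : Q * Q) : {set P} := [set p | e p T.1 && e p T.2].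

Definition common_right (d : nat) (t : d.-tuple P) : {set Q} :=
  [set q | all (e^~ q) t].

(** Counted by [p], the sizes of the sets [common_left T] add up to the sum of squared degrees.
    Convexity over [p] bounds this below, and convexity over [T] then gives the [d]-th powers. *)
Lemma sum_common_left_expr_ge (alpha : R) (d : nat) :
  0 <= alpha -> alpha * #|P|%:R * #|Q|%:R <= \sum_p \sum_q (e p q)%:R ->
  #|Q|%:R ^+ 2 * (alpha ^+ 2 * #|P|%:R) ^+ d <=
  \sum_(T : Q * Q) #|common_left T|%:R ^+ d :> R.
Proof.
move=> alpha_ge0 dense; have -> : #|Q|%:R ^+ 2 = #|{: Q * Q}|%:R :> R.
  by rewrite card_prod natrM.
apply: power_mean_le => [||]; rewrite ?mulr_ge0 ?sqr_ge0 //.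
have -> : \sum_(T : Q * Q) #|common_left T|%:R =
    \sum_p (\sum_q (e p q)%:R) ^+ 2 :> R.
  under eq_bigr do rewrite -sum1_card natr_sum big_mkcond /=.
  rewrite exchange_big /=; apply: eq_bigr => p _.
  rewrite expr2 big_distrlr /= pair_big /=; apply: eq_bigr => -[q1 q2] _ /=.
  by rewrite inE /=; case: (e p q1); case: (e p q2); rewrite /= ?mulr1 ?mulr0.
rewrite card_prod natrM.
have -> : #|Q|%:R * #|Q|%:R * (alpha ^+ 2 * #|P|%:R) =
    #|P|%:R * (alpha * #|Q|%:R) ^+ 2 :> R by ring.
apply: power_mean_le; first by rewrite mulr_ge0.
  by move=> p; apply: sumr_ge0.
by apply: le_trans dense; rewrite mulrA [_ * alpha]mulrC.
Qed.

(** Exchange the sums: [t] lies in [common_left T] only if both entries of [T] are in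
    [common_right t], so each of the [#|P| ^ d] tuples contributes at most 1. *)
Lemma sum_common_right_le (d : nat) :
  \sum_(T : Q * Q)
    \sum_(t : d.-tuple P | uniq t && all (mem (common_left T)) t)
      #|common_right t|%:R ^- 2 <= #|P|%:R ^+ d :> R.
Proof.
rewrite (exchange_big_dep predT) //= -natrX -card_tuple -sum1_card natr_sum.
apply: ler_sum => t _.
have sub : {subset [pred T | uniq t && all (mem (common_left T)) t] <=
    setX (common_right t) (common_right t)}.
  move=> [q1 q2]; rewrite !inE /= => /andP[_ /allP tA].
  by apply/andP; split; apply/allP=> p /tA /=; rewrite inE => /andP[].
rewrite sumr_const.
apply: (@le_trans _ _ (#|common_right t|%:R ^- 2 *+ (#|common_right t| ^ 2)%N)).
  apply: ler_wpMn2l; first by rewrite invr_ge0 exprn_ge0.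
  by rewrite expnS expn1 -cardsX subset_leq_card //; apply/subsetP.
(* If [common_right t] is empty, its weight is 0 because the inverse of 0 is 0. *)
rewrite -[X in X <= _]mulr_natr natrX; case: (eqVneq (#|common_right t|%:R : R) 0) => [->|nz].
  by rewrite expr2 mulr0 mulr0.
by rewrite mulVf ?expf_neq0.
Qed.

(** Factor by factor, [x * (m - i) <= m * (x - i)]. This carries the quotient condition from [#|W|]
    to the larger set [common_left T]. *)
Lemma ffact_ratio_le (m x d : nat) : (m <= x)%N ->
  (x ^ d * m ^_ d <= m ^ d * x ^_ d)%N.
Proof.
move=> le_mx; elim: d => [|d IHd]; first by rewrite !ffactn0.
rewrite !ffactnSr !expnSr.
have -> : (x ^ d * x * (m ^_ d * (m - d)) = (x ^ d * m ^_ d) * (x * (m - d)))%N.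
  by ring.
have -> : (m ^ d * m * (x ^_ d * (x - d)) = (m ^ d * x ^_ d) * (m * (x - d)))%N.
  by ring.
apply: leq_mul => //.
by rewrite !mulnBr [(x * m)%N]mulnC leq_sub2l // leq_mul2r le_mx orbT.
Qed.

(** If every [N i] with [i] in [V] had fewer than [v = #|V|] elements, the sum would be at least
    [v / (v - 1) ^ 2], where [v > 1] as the [N i] are nonempty. This decreases in [v], so it is at
    least its value at [#|I|]. *)
Lemma exists_large_of_sum_inv_sqr_lt (U I : finType) (N : I -> {set U}) :
  (0 < #|I|)%N -> (forall i, N i != set0) ->
  (#|I|%:R - 1) ^+ 2 * \sum_i #|N i|%:R ^- 2 < #|I|%:R :> R ->
  forall V : {set I}, V != set0 -> exists2 i, i \in V & (#|V| <= #|N i|)%N.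
Proof.
move=> I_gt0 N_n0 sum_lt V V_n0; apply/exists_inP; apply: contraTT sum_lt.
rewrite negb_exists_in -leNgt => /forall_inP small.
have N_gt0 i : (0 : R) < #|N i|%:R by rewrite ltr0n card_gt0.
have V_gt0 : (0 < #|V|)%N by rewrite card_gt0.
have V_gt1 : (0 : R) < #|V|%:R - 1.
  have /set0Pn[i iV] := V_n0; have := small i iV; rewrite -ltnNge => ltN.
  by rewrite subr_gt0 ltr1n (leq_ltn_trans _ ltN) // card_gt0.
have leVI : (#|V|%:R : R) <= #|I|%:R by rewrite ler_nat max_card.
have V_ge1 : (1 : R) <= #|V|%:R by rewrite ler1n.
have sumV : #|V|%:R * (#|V|%:R - 1) ^- 2 <= \sum_i #|N i|%:R ^- 2 :> R.
  rewrite mulr_natl -sumr_const big_mkcond; apply: ler_sum => i _ /=.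
  case: ifP => [iV|_]; last by rewrite invr_ge0 exprn_ge0.
  rewrite lef_pV2 ?posrE ?exprn_gt0 // ler_pXn2r ?nnegrE ?ler0n ?(ltW V_gt1) //.
  by have := small i iV; rewrite -ltnNge lerBrDr natr1 ler_nat.
apply: le_trans (ler_wpM2l (sqr_ge0 _) sumV).
rewrite mulrA ler_pdivlMr ?exprn_gt0 // -subr_ge0.
have -> : (#|I|%:R - 1) ^+ 2 * #|V|%:R - #|I|%:R * (#|V|%:R - 1) ^+ 2 =
    (#|I|%:R - #|V|%:R) * (#|I|%:R * #|V|%:R - 1) :> R by ring.
rewrite mulr_ge0 ?subr_ge0 //; nra.
Qed.

Theorem bipartite_embedding (W I : finType) (d : nat) (s : I -> d.-tuple W)
    (alpha eps : R) :
  0 <= alpha -> 0 <= eps ->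
  alpha * #|P|%:R * #|Q|%:R <= \sum_p \sum_q (e p q)%:R ->
  (forall i, uniq (s i)) -> (0 < #|I|)%N -> (d <= #|W|)%N ->
  #|W|%:R ^+ d / (#|W| ^_ d)%:R <= 1 + eps ->
  (1 + eps) * (#|I|%:R - 1) ^+ 2 * #|P|%:R ^+ d <
    #|Q|%:R ^+ 2 * ((alpha ^+ 2 * #|P|%:R) ^+ d - #|W|%:R ^+ d) ->
  exists (f : W -> P) (g : I -> Q),
    [/\ injective f, injective g & forall i w, w \in s i -> e (f w) (g i)].
Proof.
move=> alpha_ge0 eps_ge0 dense Us I_gt0 le_dW ratio gap.
pose Gamma T : R := \sum_(t : d.-tuple P | uniq t && all (mem (common_left T)) t)
      #|common_right t|%:R ^- 2.
pose K : R := (1 + eps) * (#|I|%:R - 1) ^+ 2.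
have K_ge0 : 0 <= K by rewrite mulr_ge0 ?sqr_ge0 ?addr_ge0.
have inv_ge0 (t : d.-tuple P) : 0 <= #|common_right t|%:R ^- 2 :> R.
  by rewrite invr_ge0 exprn_ge0.
have Gamma_ge0 T : 0 <= Gamma T by apply: sumr_ge0.
(* Otherwise [#|common_left T| ^ d] is at most [K * Gamma T + #|W| ^ d] for every [T]; summing over
   [T] contradicts [gap]. *)
have [T /andP[leWT lt_T]] : exists T, (#|W| <= #|common_left T|)%N &&
    (K * Gamma T < #|common_left T|%:R ^+ d).
  apply/existsP; apply: contraTT gap => /existsPn noT; rewrite -leNgt.
  rewrite mulrBr lerBlDr.
  apply: le_trans (sum_common_left_expr_ge d alpha_ge0 dense) _.
  apply: (@le_trans _ _ (\sum_(T : Q * Q) (K * Gamma T + #|W|%:R ^+ d))).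
    apply: ler_sum => T _; have := noT T; rewrite negb_and -ltnNge -leNgt.
    case/orP=> [ltT|leT]; last by rewrite ler_wpDr ?exprn_ge0.
    apply: ler_wpDl; first by rewrite mulr_ge0.
    by rewrite lerXn2r ?nnegrE // ler_nat ltnW.
  rewrite big_split /= -mulr_sumr sumr_const card_prod.
  rewrite -[X in _ + X]mulr_natl natrM.
  by rewrite lerD2r ler_wpM2l // sum_common_right_le.
have [f [f_inj fA le_f]] :=
  exists_injection_into_le_average inv_ge0 leWT Us.
rewrite -/(Gamma T) in le_f.
set A := common_left T in leWT lt_T fA le_f.
have fact_gt0 x : (d <= x)%N -> (0 : R) < (x ^_ d)%:R by rewrite ltr0n ffact_gt0.
have A_fact : (0 : R) < (#|A| ^_ d)%:R by rewrite fact_gt0 // (leq_trans le_dW).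
have W_fact : (0 : R) < (#|W| ^_ d)%:R by rewrite fact_gt0.
have ratioA : #|A|%:R ^+ d <= (1 + eps) * (#|A| ^_ d)%:R.
  rewrite -ler_pdivrMr //; apply: le_trans ratio.
  rewrite ler_pdivrMr // mulrAC ler_pdivlMr // -!natrX -!natrM ler_nat.
  exact: ffact_ratio_le.
pose S : R := \sum_i #|common_right (map_tuple f (s i))|%:R ^- 2.
have sum_lt : (#|I|%:R - 1) ^+ 2 * S < #|I|%:R.
  have pos : 0 < (1 + eps) * (#|A| ^_ d)%:R by rewrite mulr_gt0 // ltr_pwDl.
  rewrite -(ltr_pM2r pos).
  have -> : (#|I|%:R - 1) ^+ 2 * S * ((1 + eps) * (#|A| ^_ d)%:R) =
    K * (S * (#|A| ^_ d)%:R) by rewrite /K; ring.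
  apply: le_lt_trans (ler_wpM2l K_ge0 le_f) _; rewrite mulrCA ltr_pM2l ?ltr0n //.
  exact: lt_le_trans ratioA.
(* [T.1] is adjacent to all of [A], where [f] takes its values. *)
have N_n0 i : common_right (map_tuple f (s i)) != set0.
  apply/set0Pn; exists T.1; rewrite inE; apply/allP=> _ /mapP[w _ ->].
  by have := fA w; rewrite inE => /andP[].
have [g g_inj gN] := greedy_transversal (exists_large_of_sum_inv_sqr_lt I_gt0 N_n0 sum_lt).
exists f, g; split=> // i w w_s; have := gN i; rewrite inE => /allP; apply.
exact: map_f.
Qed.

End Bipartite.

(** * Splitting a graph without losing density *)

Section Graphs.
Variables (R : realFieldType) (G : sgraph).

Lemma card_edges_le : (#|edges G| <= 'C(#|G|, 2))%N.
Proof.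
rewrite -cardsT -cards_draws; apply: subset_leq_card; apply/subsetP=> E.
rewrite !inE subsetT => /existsP[x /existsP[y /andP[xy /eqP ->]]].
by rewrite cards2 (_ : x != y) //; apply: contraTneq xy => ->; rewrite adj_irrefl.
Qed.

(** Every edge has two orderings. Ordered pairs are 2-tuples, to fit the averaging over
    injections. *)
Lemma double_edges_le : (2 * #|edges G| <= \sum_(t : 2.-tuple G | uniq t)
  adj (tnth t ord0) (tnth t (lift ord0 ord0)))%N.
Proof.
pose D := [set t : 2.-tuple G | adj (tnth t ord0) (tnth t (lift ord0 ord0))].
pose ends (t : 2.-tuple G) := [set tnth t ord0; tnth t (lift ord0 ord0)].
have D_uniq t : t \in D -> uniq t.
  rewrite inE; case/tupleP: t => x t; case/tupleP: t => y t; rewrite (tuple0 t).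
  rewrite !(tnth_nth x) /= !inE !andbT; apply: contraTneq => ->.
  by rewrite adj_irrefl.
have -> : (\sum_(t : 2.-tuple G | uniq t)
    adj (tnth t ord0) (tnth t (lift ord0 ord0)) = \sum_(t in D) 1)%N.
  rewrite big_mkcond [RHS]big_mkcond; apply: eq_bigr => t _.
  case: ifP => [_|Ut]; first by rewrite inE; case: adj.
  by case: ifP => // /D_uniq; rewrite Ut.
rewrite (partition_big ends (mem (edges G))) /= => [|t]; last first.
  rewrite !inE => tD; apply/existsP; exists (tnth t ord0).
  by apply/existsP; exists (tnth t (lift ord0 ord0)); rewrite tD /=.
rewrite mulnC -sum_nat_const; apply: leq_sum => E.
rewrite inE => /existsP[x /existsP[y /andP[xy /eqP ->]]].
have xNy : x != y by apply: contraTneq xy => ->; rewrite adj_irrefl.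
rewrite sum1_card; apply: (@leq_trans #|[set [tuple x; y]; [tuple y; x]]|).
  by rewrite cards2 -val_eqE /= eqseq_cons (negbTE xNy).
apply: subset_leq_card; apply/subsetP=> t; rewrite !inE unfold_in /= inE /ends.
by case/orP=> /eqP ->; rewrite !(tnth_nth x) /= ?xy ?eqxx // adj_sym xy setUC /=.
Qed.

(** A random injection sends each cross pair to a uniform ordered pair of distinct vertices, so the
    mean number of cross edges is at least [a * b] times the density. *)
Lemma exists_dense_split (alpha : R) (a b : nat) :
  0 < alpha -> alpha <= #|edges G|%:R / 'C(#|G|, 2)%:R -> (a + b)%N = #|G| ->
  exists2 h : 'I_a + 'I_b -> G, injective h &
    alpha * a%:R * b%:R <=
      \sum_(p : 'I_a) \sum_(q : 'I_b) (adj (h (inl p)) (h (inr q)))%:R.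
Proof.
move=> alpha_gt0 dense abG.
have C_gt0 : (0 : R) < 'C(#|G|, 2)%:R.
  rewrite ltr0n lt0n; apply: contraTneq (lt_le_trans alpha_gt0 dense) => ->.
  by rewrite invr0 mulr0 ltxx.
have le_hG : (#|{: 'I_a + 'I_b}| <= #|G|)%N by rewrite card_sum !card_ord abG.
pose s (z : 'I_a * 'I_b) : 2.-tuple ('I_a + 'I_b) := [tuple inl z.1; inr z.2].
(* The sign turns the upper bound given by averaging into a lower bound. *)
pose g (t : 2.-tuple G) : R := - (adj (tnth t ord0) (tnth t (lift ord0 ord0)))%:R.
have [h h_inj] := @exists_injection_le_average R _ _ _ _ s g le_hG (fun=> isT).
have -> : \sum_i g (map_tuple h (s i)) =
    - \sum_(p : 'I_a) \sum_(q : 'I_b) (adj (h (inl p)) (h (inr q)))%:R.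
  rewrite sumrN pair_big /=; congr (- _); exact: eq_bigr.
rewrite sumrN mulNr mulrN lerN2 card_prod !card_ord natrM => avg.
exists h => //.
have F_gt0 : (0 : R) < (#|G| ^_ 2)%:R by rewrite -bin_ffact natrM mulr_gt0.
rewrite -(ler_pM2r F_gt0); apply: le_trans avg.
have -> : alpha * a%:R * b%:R * (#|G| ^_ 2)%:R =
    a%:R * b%:R * (alpha * (#|G| ^_ 2)%:R) by ring.
apply: ler_wpM2l; first by rewrite mulr_ge0.
rewrite -natr_sum; apply: le_trans (_ : _ <= (2 * #|edges G|)%:R) _; last first.
  by rewrite ler_nat double_edges_le.
rewrite -bin_ffact natrM mulrA natrM mulrC ler_pM2l ?ltr0n //.
by rewrite -ler_pdivlMr.
Qed.

End Graphs.

(** * Numerical estimate and embedding of [H] *)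

Lemma uniq_tuple_superset (W : finType) (B : {set W}) (d : nat) :
  (#|B| <= d)%N -> (d <= #|W|)%N ->
  exists2 t : d.-tuple W, uniq t & {subset B <= t}.
Proof.
move=> leBd ledW; pose l := enum B ++ enum (~: B).
have size_l : size l = #|W| by rewrite size_cat -!cardE cardsC.
have Ul : uniq l.
  rewrite cat_uniq !enum_uniq andbT /=; apply/hasPn=> x.
  by rewrite !mem_enum inE.
have size_t : size (take d l) == d by rewrite size_takel // size_l.
exists (Tuple size_t) => [|x xB]; first exact: take_uniq.
rewrite -[_ \in _]/(x \in take d l) take_cat -cardE.
case: ltnP => [ltd|_]; last by rewrite mem_cat mem_enum xB.
by have := leq_trans ltd leBd; rewrite ltnn.
Qed.

(* [m, r, a, b] stand for |W2|, |W1|, |P|, |Q|.  Only [b > nu * (r - 1)] is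
   available, not [b >= nu * r], because |P| has to be rounded to an integer. *)
Lemma split_gap (R : realFieldType) (k : nat) (alpha eps nu m r a b : R) :
  0 < alpha -> 0 <= eps -> 0 < nu -> nu * alpha ^+ k.+2 = 1 + eps ->
  alpha ^+ (k.+2 * k) <= eps -> 0 <= m -> m * nu <= a -> 0 < a ->
  1 <= r -> nu * (r - 1) < b ->
  (1 + eps) * (r - 1) ^+ 2 * a ^+ k.+2 <
    b ^+ 2 * ((alpha ^+ 2 * a) ^+ k.+2 - m ^+ k.+2).
Proof.
move=> alpha_gt0 eps_ge0 nu_gt0 nuE le_eps m_ge0 le_ma a_gt0 r_ge1 lt_b.
have ad_gt0 : 0 < a ^+ k.+2 by rewrite exprn_gt0.
(* With [d = k + 2], [alpha ^ (d * k) * nu ^ k = (nu * alpha ^ d) ^ k = (1 + eps) ^ k]. *)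
have eps_nu : 1 <= eps * nu ^+ k.
  apply: le_trans (ler_wpM2r (exprn_ge0 _ (ltW nu_gt0)) le_eps).
  by rewrite exprM -exprMn [_ * nu]mulrC nuE exprn_ege1 // lerDl.
have le_m : nu ^+ 2 * m ^+ k.+2 <= eps * a ^+ k.+2.
  apply: (@le_trans _ _ (eps * (m * nu) ^+ k.+2)); last first.
    by rewrite ler_wpM2l // lerXn2r ?nnegrE ?mulr_ge0 ?(ltW nu_gt0) ?(ltW a_gt0).
  have -> : eps * (m * nu) ^+ k.+2 =
      eps * nu ^+ k * (nu ^+ 2 * m ^+ k.+2) by rewrite exprMn !exprS; ring.
  by rewrite ler_peMl // mulr_ge0 ?exprn_ge0 // ltW.
set D := _ - m ^+ k.+2.
(* This rests on [(1 + eps) ^ 2 - eps >= 1 + eps]. *)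
have le_D : (1 + eps) * a ^+ k.+2 <= nu ^+ 2 * D.
  have -> : nu ^+ 2 * D =
      (nu * alpha ^+ k.+2) ^+ 2 * a ^+ k.+2 - nu ^+ 2 * m ^+ k.+2.
    by rewrite /D mulrBr [(alpha ^+ 2 * a) ^+ _]exprMn [(nu * _) ^+ 2]exprMn
      exprAC mulrA.
  by rewrite nuE; nra.
have D_gt0 : 0 < D.
  have : 0 < nu ^+ 2 * D by apply: lt_le_trans le_D; rewrite mulr_gt0 // ltr_pwDl.
  by rewrite pmulr_rgt0 // exprn_gt0.
apply: (@le_lt_trans _ _ ((nu * (r - 1)) ^+ 2 * D)).
  rewrite mulrAC [(nu * _) ^+ 2]exprMn [leRHS]mulrAC.
  by apply: ler_wpM2r => //; apply: sqr_ge0.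
by rewrite ltr_pM2r // ltrXn2r // ?mulr_ge0 ?subr_ge0 ?(ltW nu_gt0) //.
Qed.

Unset Implicit Arguments.

Theorem theorem1p3 (R : realType) (d n : nat) (alpha eps : R) (G : sgraph)
    (halpha : 0 < alpha) (heps : 0 < eps)
    (halphaeps : alpha ^ (d%:Z * (d%:Z - 2%:Z)) <= eps) (heps1 : eps < 1)
    (hG : #|G|%:R = (1 + eps) * alpha ^- d * n%:R)
    (hdens : alpha <= density R G) :
  universal G (bipartite_family d n eps).
Proof.
move=> H [cardH [W1 [W2 [[covW disW] [indW1 indW2] degW1 le_dW2 ratio]]]].
case: d halphaeps hG degW1 le_dW2 ratio => [|[|k]] halphaeps hG degW1 le_dW2 ratio.
(* For [d = 0] the exponent is 0, giving [1 <= eps]. For [d = 1] it is -1, so [alpha > 1] exceeds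
   every density. *)
- by move: halphaeps; rewrite mul0r expr0z leNgt heps1.
- move: halphaeps; rewrite mul1r => /le_lt_trans/(_ heps1).
  rewrite (_ : _ - _ = -1 :> int) // exprN1 invf_lt1 // => alpha_gt1.
  have := lt_le_trans alpha_gt1 hdens; rewrite ltNge /density.
  case: (posnP 'C(#|G|, 2)) => [->|C_gt0]; first by rewrite invr0 mulr0 ler01.
  by rewrite ler_pdivrMr ?ltr0n // mul1r ler_nat card_edges_le.
set d := k.+2 in halphaeps hG degW1 le_dW2 ratio *.
have le_eps : alpha ^+ (d * k) <= eps.
  by move: halphaeps; have -> : d%:Z * (d%:Z - 2%:Z) = (d * k)%N%:Z by rewrite /d; lia.
have alpha_lt1 : alpha < 1.
  rewrite ltNge; apply/negP=> alpha_ge1.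
  by have := lt_le_trans heps1 (exprn_ege1 (d * k) alpha_ge1); rewrite ltNge le_eps.
pose nu := (1 + eps) * alpha ^- d.
have ad_gt0 : 0 < alpha ^+ d by rewrite exprn_gt0.
have nuE : nu * alpha ^+ d = 1 + eps by rewrite /nu divfK // gt_eqF.
have nu_gt1 : 1 < nu.
  rewrite -(ltr_pM2r ad_gt0) nuE mul1r.
  have : alpha ^+ d <= 1 by rewrite exprn_ile1 // ltW.
  by move=> ?; lra.
have nu_gt0 : 0 < nu by lra.
pose W : finType := {x : H | x \in W2}; pose I : finType := {x : H | x \in W1}.
have cardW : #|W| = #|W2| by rewrite card_sig.
have cardI : #|I| = #|W1| by rewrite card_sig.
have card_n : n = (#|W| + #|I|)%N.
  rewrite cardW cardI -cardH -cardsT -covW cardsU addnC.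
  by move: disW; rewrite -setI_eq0 => /eqP ->; rewrite cards0 subn0.
(* If [W1] is empty, [H] has no edges and any injection works. *)
have [I0|I_gt0] := posnP #|I|.
  have [|f f_inj] := @exists_injection H G.
    rewrite cardH -(ler_nat R) hG -/nu; have : (0 : R) <= n%:R by [].
    by move=> ?; nra.
  exists f; split=> // x y xy; have inW2 z : z \in W2.
    have := in_setT z; rewrite -covW inE => /orP[zW1|//].
    by have := card0_eq (etrans (esym cardI) I0) z; rewrite zW1.
  by have := indW2 x y (inW2 x) (inW2 y); rewrite xy.
(* The least integer strictly above [#|W| * nu], hence positive. Rounding costs at most 1, which is
   less than [nu], so the other side keeps more than [nu * (#|I| - 1)] vertices. *)
pose a := (Num.truncn (#|W|%:R * nu)).+1.
have /andP[a_le a_gt] : a%:R - 1 <= #|W|%:R * nu < a%:R.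
  have := @truncn_itv R (#|W|%:R * nu); rewrite mulr_ge0 ?(ltW nu_gt0) // => /(_ isT).
  by rewrite /a -natr1 addrK.
have I_ge1 : (1 : R) <= #|I|%:R by rewrite ler1n.
have hG' : #|G|%:R = nu * (#|W|%:R + #|I|%:R) by rewrite hG card_n natrD.
have le_aG : (a <= #|G|)%N.
  have : (a%:R : R) < #|G|.+1%:R by rewrite -natr1 hG'; nra.
  by rewrite ltr_nat ltnS.
pose b := (#|G| - a)%N.
have bE : b%:R = #|G|%:R - a%:R :> R by rewrite natrB.
have [h h_inj dense] := exists_dense_split halpha hdens (subnKC le_aG).
(* Neighbourhoods are padded to exactly [d] distinct vertices, for which [d <= #|W2|] leaves
   room. *)
have exists_s (i : I) : exists t : d.-tuple W,
    uniq t /\ forall w : W, adj (val i) (val w) -> w \in t.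
  have [||t Ut tB] := @uniq_tuple_superset W [set w | adj (val i) (val w)] d.
  - apply: leq_trans (degW1 _ (valP i)).
    rewrite -(card_imset _ val_inj); apply: subset_leq_card.
    apply/subsetP=> z /imsetP[w iw ->]; move: iw; rewrite !inE => ->.
    by rewrite (valP w).
  - by rewrite cardW.
  by exists t; split=> // w iw; apply: tB; rewrite inE.
have [s sP] := fin_all_exists exists_s.
have [||||||||f [g [f_inj g_inj fgP]]] := @bipartite_embedding R _ _
    (fun (p : 'I_a) (q : 'I_b) => adj (h (inl p)) (h (inr q))) W I d s alpha eps.
- exact: ltW.
- exact: ltW.
- by rewrite !card_ord.
- by move=> i; have [] := sP i.
- by [].
- by rewrite cardW.
- by rewrite cardW.
- rewrite !card_ord; apply: (@split_gap _ _ _ _ nu) => //; rewrite ?ltW //.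
  rewrite bE hG'; nra.
(* Glue [f] on [W2] and [g] on [W1]; specifying the value through both subtypes avoids casts on
   membership proofs. *)
have exists_phi (x : H) : exists z : 'I_a + 'I_b,
    (forall w : W, val w = x -> z = inl (f w)) /\
    (forall i : I, val i = x -> z = inr (g i)).
  have := in_setT x; rewrite -covW inE => /orP[xW|xW].
    exists (inr (g (Sub x xW))); split=> [w wx|i ix].
      by have : val w \in W2 := valP w; rewrite wx (disjointFr disW xW).
    by do 2![congr (_ _)]; apply: val_inj; rewrite SubK.
  exists (inl (f (Sub x xW))); split=> [w wx|i ix].
    by do 2![congr (_ _)]; apply: val_inj; rewrite SubK.
  by have : val i \in W1 := valP i; rewrite ix (disjointFl disW xW).
have [phi phiP] := fin_all_exists exists_phi.
have side (x : H) : (exists w : W, val w = x) \/ (exists i : I, val i = x).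
  have := in_setT x; rewrite -covW inE => /orP[xW|xW]; [right|left];
  by exists (Sub x xW); rewrite SubK.
have phiW (w : W) : phi (val w) = inl (f w) by apply: (phiP (val w)).1.
have phiI (i : I) : phi (val i) = inr (g i) by apply: (phiP (val i)).2.
have adj_phi (i : I) (w : W) : adj (val i) (val w) ->
    adj (h (phi (val w))) (h (phi (val i))).
  by move=> iw; rewrite phiW phiI; apply: fgP; apply: (sP i).2.
exists (h \o phi); split=> [x y /h_inj|x y] /=.
  case: (side x) => -[u <-]; case: (side y) => -[v <-];
    rewrite ?phiW ?phiI // => -[].
  - by move/f_inj ->.
  - by move/g_inj ->.
case: (side x) => -[u <-]; case: (side y) => -[v <-] uv.
- by have := indW2 _ _ (valP u) (valP v); rewrite uv.
- by apply: adj_phi; rewrite adj_sym.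
- by rewrite adj_sym; apply: adj_phi.
- by have := indW1 _ _ (valP u) (valP v); rewrite uv.
Qed.
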